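(* Let $X$ be a random variable taking values in $\mathbb{R}$, with finite moments of all positive orders, and let $m_{2k}=\mathbf{E}[X^{2k}]$. Then the following four statements are equivalent: (i) $m_{2k}=\mathcal{O}((2k)^{2k})$ as $k\to\infty$. (ii) $\limsup_{k\to\infty}\frac{1}{2k}\,m_{2k}^{1/(2k)}<\infty$. (iii) $m_{2k}\le c_0^k\,(2k)!$, $k=1,2,\ldots$, for some constant $c_0>0$. (iv) $X$ satisfies Cramér's condition: its moment generating function exists.
   Context: Existence of the moment generating function (Cramér's condition) means that $\mathbf{E}[e^{tX}]<\infty$ for all $t$ in some open neighbourhood of $0$.
   Formalization: Statement (i) is taken as m_{2k} = O((C·2k)^{2k}) for some constant C > 0, since with C = 1 as printed the equivalence fails (X three times a standard Laplace variable satisfies (ii)–(iv) but not (i)). *)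

(* Defs.v *)
From HB Require Import structures.
From mathcomp Require Import all_boot all_order all_algebra.
From mathcomp Require Import all_classical all_reals all_analysis.

Set Implicit Arguments.
Unset Strict Implicit.
Unset Printing Implicit Defensive.

Import Order.TTheory GRing.Theory Num.Theory.
Import numFieldNormedType.Exports.
Local Open Scope classical_set_scope.
Local Open Scope ring_scope.

Definition finite_moments (d : measure_display) (T : measurableType d)
    (R : realType) (P : probability T R) (X : {RV P >-> R}) : Prop :=
  forall n : nat, (0 < n)%N -> P.-integrable setT (EFin \o (fun w => X w ^+ n)).

(* [fine] loses nothing when [finite_moments X] holds: the expectation is then
   a finite extended real. *)
Definition moment (d : measure_display) (T : measurableType d)
    (R : realType) (P : probability T R) (X : {RV P >-> R}) (n : nat) : R :=
  fine 'E_P[fun w => X w ^+ n].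

Definition cramer_condition (d : measure_display) (T : measurableType d)
    (R : realType) (P : probability T R) (X : {RV P >-> R}) : Prop :=
  \forall t \near (0 : R), ('M_P X t < +oo)%E.

(* Main.v *)
Require Import Defs.
From HB Require Import structures.
From mathcomp Require Import all_boot all_order all_algebra.
From mathcomp Require Import all_classical all_reals all_analysis.
From mathcomp Require Import measurable_realfun lra.

Set Implicit Arguments.
Unset Strict Implicit.
Unset Printing Implicit Defensive.

Import Order.TTheory GRing.Theory Num.Theory.
Import numFieldNormedType.Exports.
Local Open Scope classical_set_scope.
Local Open Scope ring_scope.

(** The bridge between moments and exponentials is the cosh series: the odd
    terms of exp (tX) + exp (-tX) cancel and the even ones are nonnegative, so
    Tonelli gives, in the extended reals and with no convergence assumption,

      M(t) + M(-t) = 2 * \sum_k t^(2k) m_2k / (2k)!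

    where M is the moment generating function (mmt_gen_fun_addN_series).  A
    geometric bound m_2k <= c^k (2k)! therefore makes M finite as soon as
    t^2 c < 1, and conversely, if M is finite at t and -t, then each single term
    of the series is bounded by the left-hand side, whence
    m_2k = O((2k)! / t^(2k)).

    The remaining implications concern nonnegative real sequences only and rest
    on n! and n^n agreeing up to a geometric factor: n! <= n^n, and
    n^n / n! <= e^n because the left-hand side is one term of the series of e^n.
    Such factors C^(2k) are harmless: the root test turns them into the constant
    C, and in m_2k <= c0^k (2k)! they are absorbed by c0. *)

(** * Powers, factorials and the cosh series *)

Lemma fact_le_expn (n : nat) : (n`! <= n ^ n)%N.
Proof.
rewrite fact_prod big_add1 /= -[X in (_ <= _ ^ X)%N]card_ord -prod_nat_const.
by rewrite big_mkord; exact: leq_prod.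
Qed.

Lemma powR_inv_le (R : realType) (a b : R) (n : nat) :
  (0 < n)%N -> 0 <= a -> 0 <= b -> (a `^ n%:R^-1 <= b) = (a <= b ^+ n).
Proof.
move=> n0 a0 b0; rewrite -(@ler_pXn2r _ n)// ?nnegrE ?powR_ge0//.
rewrite -(powR_mulrn n (powR_ge0 _ _)) -powRrM mulVf ?powRr1//.
by rewrite pnatr_eq0 -lt0n.
Qed.

Lemma expr_div_fact_le_expR (R : realType) (x : R) (n : nat) :
  0 <= x -> x ^+ n / n`!%:R <= expR x.
Proof.
case: n => [|n] x0; first by rewrite expr0 fact0 divr1 -expR0 ler_expR.
by apply: le_trans (expR_ge1Dxn n x0); rewrite lerDr.
Qed.

Lemma expR_add_expRN_series (R : realType) (x : R) :
  ((expR x + expR (- x))%:E =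
   \sum_(0 <= n <oo) (exp_coeff x n + exp_coeff (- x) n)%:E)%E.
Proof.
apply/esym/cvg_lim => //=.
rewrite (_ : (fun _ => _) =
  EFin \o (series (exp_coeff x) \+ series (exp_coeff (- x)))); last first.
  by apply/funext => n /=; rewrite sumEFin big_split.
by apply: cvg_EFin; [exact: nearW|apply: cvgD; exact: is_cvg_series_exp_coeff].
Qed.

Lemma exp_coeff_addN (R : realType) (x : R) (n : nat) :
  exp_coeff x n + exp_coeff (- x) n =
  if odd n then 0 else 2 * (x ^+ n / n`!%:R).
Proof.
rewrite /exp_coeff /= exprNn -signr_odd; case: odd.
  by rewrite expr1 mulN1r mulNr subrr.
by rewrite mul1r mulr2n mulrDl mul1r.
Qed.

(** * Growth of nonnegative sequences *)

(** The multiplicative constant M of the big O can be absorbed into the base,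
    since M <= (M + 1)^(2k) for k >= 1: the (2k)-th roots are then at most
    (M + 1) C (2k). *)
Lemma limn_esup_root_lty (R : realType) (m : nat -> R)
    (m_ge0 : forall k, 0 <= m k) :
  (exists2 C : R, 0 < C &
     (m : nat -> R^o) =O_\oo
     (fun k : nat => (C * (2 * k)%:R) ^+ (2 * k) : R^o)) ->
  (limn_esup (fun k : nat =>
     ((2 * k)%:R^-1 * m k `^ (2 * k)%:R^-1)%:E) < +oo)%E.
Proof.
move=> [C C0] /eqO_exP[M M0 [N _ mN]].
apply: (@le_lt_trans _ _ ((M + 1) * C)%:E); last exact: ltry.
apply: (@le_trans _ _ (ereal_sup [set ((2 * k)%:R^-1 * m k `^ (2 * k)%:R^-1)%:E
  | k in [set k | (N < k)%N]])).
  apply: ereal_inf_lbound => /=.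
  by exists [set k | (N < k)%N] => //; exists N.+1.
apply: ge_ereal_sup => _ [k /= Nk <-]; rewrite lee_fin.
have n0 : (0 < 2 * k)%N by rewrite muln_gt0 (leq_trans _ Nk).
have M1 : 1 <= M + 1 by rewrite lerDr ltW.
have Cn0 : 0 <= C * (2 * k)%:R by rewrite mulr_ge0// ltW.
rewrite ler_pdivrMl ?ltr0n// [leRHS]mulrC -mulrA.
rewrite powR_inv_le// ?mulr_ge0 ?(le_trans _ M1) ?(ltW C0)//.
have := mN k (ltnW Nk).
rewrite /= !ger0_norm ?exprn_ge0// => /le_trans -> //.
rewrite [leRHS]exprMn ler_wpM2r ?exprn_ge0//.
by rewrite (le_trans _ (ler_eXnr n0 M1))// lerDl.
Qed.

(** A finite limsup bounds m k by (A (2k))^(2k) for large k, and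
    (2k)^(2k) <= e^(2k) (2k)!; the finitely many other terms are absorbed by
    enlarging the constant. *)
Lemma factorial_bound_of_root (R : realType) (m : nat -> R)
    (m_ge0 : forall k, 0 <= m k) :
  (limn_esup (fun k : nat =>
     ((2 * k)%:R^-1 * m k `^ (2 * k)%:R^-1)%:E) < +oo)%E ->
  exists2 c0 : R, 0 < c0 &
    forall k : nat, (1 <= k)%N -> m k <= c0 ^+ k * ((2 * k)`!)%:R.
Proof.
move=> /ereal_inf_lt[_ [V [N _ NV] <-]] supV.
have [A A0 mA] : exists2 A : R, 0 <= A & forall k, (N <= k)%N -> (0 < k)%N ->
    m k <= (A * (2 * k)%:R) ^+ (2 * k).
  pose s := ereal_sup [set ((2 * k)%:R^-1 * m k `^ (2 * k)%:R^-1)%:E | k in V].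
  have ub k : V k -> (((2 * k)%:R^-1 * m k `^ (2 * k)%:R^-1)%:E <= s)%E.
    by move=> Vk; apply: ereal_sup_ubound; exists k.
  have s0 : (0 <= s)%E.
    apply: le_trans (ub N (NV _ (leqnn N))).
    by rewrite lee_fin mulr_ge0 ?invr_ge0 ?powR_ge0.
  have sE : (s = (fine s)%:E)%E by rewrite fineK// ge0_fin_numE.
  have A0 : 0 <= fine s by rewrite fine_ge0.
  exists (fine s) => // k Nk k0.
  have n0 : (0 < 2 * k)%N by rewrite muln_gt0.
  have := ub k (NV _ Nk); rewrite sE lee_fin ler_pdivrMl ?ltr0n// mulrC.
  by rewrite powR_inv_le// mulr_ge0.
(* The three summands of c serve large k, the monotonicity c <= c ^+ k, and the
   terms of index below N. *)
pose S := \sum_(i < N) m i.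
have S0 : 0 <= S by exact: sumr_ge0.
pose c := (A * expR 1) ^+ 2 + 1 + S.
have c1 : 1 <= c by rewrite /c -addrA addrCA lerDl addr_ge0// sqr_ge0.
have c0 : 0 <= c by exact: le_trans c1.
have Ac : (A * expR 1) ^+ 2 <= c by rewrite /c -addrA lerDl addr_ge0.
exists c; first exact: lt_le_trans c1.
move=> k k0; have [Nk|kN] := leqP N k; last first.
  apply: (@le_trans _ _ c).
    rewrite /c /S (bigD1 (Ordinal kN))//= addrCA lerDl.
    by rewrite !addr_ge0 ?sqr_ge0// sumr_ge0.
  by rewrite -[leLHS]mulr1 ler_pM ?ler_eXnr// ler1n fact_gt0.
apply: (le_trans (mA k Nk k0)).
apply: (@le_trans _ _ ((A * expR 1) ^+ (2 * k) * (2 * k)`!%:R)); last first.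
  by rewrite ler_wpM2r// exprM lerXn2r ?nnegrE ?sqr_ge0.
rewrite !exprMn -mulrA ler_wpM2l ?exprn_ge0//.
rewrite -ler_pdivrMr ?ltr0n ?fact_gt0// -expRM_natl mulr1.
exact: expr_div_fact_le_expR.
Qed.

(** * Moments and the moment generating function *)

Lemma moment_even_ge0 (d : measure_display) (T : measurableType d)
    (R : realType) (P : probability T R) (X : {RV P >-> R})
    (k : nat) : 0 <= moment X (2 * k).
Proof.
by apply/fine_ge0/expectation_ge0 => w; rewrite exprM exprn_ge0// sqr_ge0.
Qed.

Lemma integrable_RV_exprn (d : measure_display) (T : measurableType d)
    (R : realType) (P : probability T R) (X : {RV P >-> R})
    (hX : finite_moments X) (n : nat) :
  P.-integrable setT (fun w => (X w ^+ n)%:E).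
Proof.
case: n => [|n]; last exact: hX.
apply: (eq_integrable _ (cst 1%E)) => //.
exact: finite_measure_integrable_cst.
Qed.

Lemma momentE (d : measure_display) (T : measurableType d)
    (R : realType) (P : probability T R) (X : {RV P >-> R})
    (hX : finite_moments X) (n : nat) :
  (moment X n)%:E = (\int[P]_w (X w ^+ n)%:E)%E.
Proof.
rewrite /moment unlock fineK//.
exact: (integrable_fin_num measurableT (integrable_RV_exprn hX n)).
Qed.

Lemma measurable_expR_RV (d : measure_display) (T : measurableType d)
    (R : realType) (P : probability T R) (X : {RV P >-> R})
    (t : R) :
  measurable_fun setT (fun w => expR (X w * t)).
Proof.
apply: measurableT_comp => //.
exact: measurable_funM.
Qed.

Lemma mmt_gen_fun_ge0 (d : measure_display) (T : measurableType d)
    (R : realType) (P : probability T R) (X : {RV P >-> R})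
    (t : R) : (0 <= 'M_P X t)%E.
Proof. by apply: expectation_ge0 => w; exact: expR_ge0. Qed.

(** All terms being nonnegative, the cosh series can be integrated term by term
    whether or not either side is finite. *)
Lemma mmt_gen_fun_addN_series (d : measure_display) (T : measurableType d)
    (R : realType) (P : probability T R) (X : {RV P >-> R})
    (hX : finite_moments X) (t : R) :
  ('M_P X t + 'M_P X (- t) =
   \sum_(0 <= n <oo)
     (if odd n then 0 else 2 * (t ^+ n / n`!%:R * moment X n))%:E)%E.
Proof.
have coefE w n : exp_coeff (X w * t) n + exp_coeff (- (X w * t)) n =
    (if odd n then 0 else 2 * (t ^+ n / n`!%:R)) * X w ^+ n.
  rewrite exp_coeff_addN; case: odd; first by rewrite mul0r.
  by rewrite exprMn -!mulrA [X in 2 * X]mulrC -!mulrA.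
have coef_ge0 w n : 0 <= exp_coeff (X w * t) n + exp_coeff (- (X w * t)) n.
  rewrite exp_coeff_addN; case: ifPn => // on.
  by rewrite mulr_ge0// divr_ge0// exprn_even_ge0.
have -> : ('M_P X t + 'M_P X (- t) =
    \int[P]_w (expR (X w * t) + expR (- (X w * t)))%:E)%E.
  rewrite /mmt_gen_fun unlock /=.
  under [RHS]eq_integral do rewrite EFinD -mulrN.
  by rewrite ge0_integralD//; exact/measurable_EFinP/measurable_expR_RV.
under eq_integral do rewrite expR_add_expRN_series.
rewrite integral_nneseries//; last 2 first.
- move=> n; apply/measurable_EFinP.
  under eq_fun do rewrite coefE.
  by apply: measurable_funM => //; exact: measurable_funX.
- by move=> n w _; rewrite lee_fin.
apply: eq_eseriesr => n _.
under eq_integral do rewrite coefE EFinM.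
rewrite integralZl//; last exact: integrable_RV_exprn.
rewrite -momentE// -EFinM; case: odd; first by rewrite mul0r.
by rewrite -(mulrA 2).
Qed.

Lemma mmt_series_term_ge0 (d : measure_display) (T : measurableType d)
    (R : realType) (P : probability T R) (X : {RV P >-> R})
    (t : R) (n : nat) :
  0 <= (if odd n then 0 else 2 * (t ^+ n / n`!%:R * moment X n)).
Proof.
case: ifPn => // on.
have nE : n = (2 * n./2)%N.
  by rewrite mul2n -[LHS]odd_double_half (negbTE on).
rewrite mulr_ge0// mulr_ge0//; last by rewrite nE moment_even_ge0.
by rewrite divr_ge0// exprn_even_ge0.
Qed.

(** The left-hand side is half of one term of the nonnegative series for
    M(t) + M(-t). *)
Lemma moment_even_le_mmt (d : measure_display) (T : measurableType d)
    (R : realType) (P : probability T R) (X : {RV P >-> R})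
    (hX : finite_moments X) (t : R) (k : nat) :
  ((t ^+ (2 * k) / (2 * k)`!%:R * moment X (2 * k))%:E <=
   'M_P X t + 'M_P X (- t))%E.
Proof.
have term_ge0 n := mmt_series_term_ge0 X t n.
rewrite mmt_gen_fun_addN_series// (nneseriesD1 (n := (2 * k)%N))//; last first.
  by move=> n _; rewrite lee_fin.
apply: le_trans (leeDl _ _); last first.
  by apply: nneseries_ge0 => n _ _; rewrite lee_fin.
have := term_ge0 (2 * k)%N.
rewrite mul2n odd_double lee_fin pmulr_rge0// => term0.
by rewrite mulr_natl mulr2n lerDl.
Qed.

(** The bound turns the cosh series into one dominated by a geometric series
    of ratio t^2 c0; M(t) <= M(t) + M(-t) then gives finiteness. *)
Lemma cramer_of_factorial_bound (d : measure_display) (T : measurableType d)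
    (R : realType) (P : probability T R) (X : {RV P >-> R})
    (hX : finite_moments X) :
  (exists2 c0 : R, 0 < c0 & forall k : nat, (1 <= k)%N ->
     moment X (2 * k) <= c0 ^+ k * ((2 * k)`!)%:R) ->
  cramer_condition X.
Proof.
move=> [c c0 mc].
(* The bound is only assumed for k >= 1, but m_0 = 1. *)
have mc' k : moment X (2 * k) <= c ^+ k * ((2 * k)`!)%:R.
  have [->|/mc//] := posnP k.
  rewrite -lee_fin momentE// muln0 fact0 mulr1 expr0.
  under eq_integral do rewrite expr0.
  by rewrite integral_cst//= probability_setT mule1.
(* For |t| below this radius t^2 c <= 1/4, so the terms of the cosh series are at
   most 2 (1/2)^n. *)
have r0 : 0 < Num.sqrt (c^-1 / 4) by rewrite sqrtr_gt0 divr_gt0 ?invr_gt0.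
apply: filterS (@pseudometric_normed_Zmodule.nbhs0_lt R R^o _ r0) => t tr.
have tc : t ^+ 2 * c <= 4^-1.
  rewrite -ler_pdivlMr// mulrC -real_normK ?num_real//.
  rewrite -[leRHS]sqr_sqrtr; last by rewrite divr_ge0// invr_ge0 ltW.
  by rewrite lerXn2r ?nnegrE ?sqrtr_ge0// ltW.
apply: (@le_lt_trans _ _ ('M_P X t + 'M_P X (- t))%E).
  by rewrite leeDl// mmt_gen_fun_ge0.
rewrite mmt_gen_fun_addN_series//.
apply: (@le_lt_trans _ _ (\sum_(0 <= n <oo) (4 / (2 ^ (n + 1))%:R)%:E)%E).
  apply: lee_nneseries => n _ => [_|]; rewrite lee_fin.
    exact: mmt_series_term_ge0.
  case: ifPn => // on.
  have [k ->] : exists k, n = (2 * k)%N.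
    by exists n./2; rewrite mul2n -[LHS]odd_double_half (negbTE on).
  apply: (@le_trans _ _ (2 * (t ^+ 2 * c) ^+ k)).
    rewrite ler_wpM2l// mulrAC exprMn -exprM.
    rewrite ler_pdivrMr ?ltr0n ?fact_gt0// -mulrA ler_wpM2l//.
    by rewrite exprM exprn_ge0 ?sqr_ge0.
  apply: (@le_trans _ _ (2 * 4^-1 ^+ k)).
    by rewrite ler_wpM2l// lerXn2r ?nnegrE// mulr_ge0 ?sqr_ge0// ltW.
  rewrite le_eqVlt; apply/predU1P; left.
  rewrite natrX addn1 exprS exprM exprVn invfM mulrA -(natrX _ 2 2).
  by congr (_ * _); lra.
by rewrite (cvg_lim _ (@cvg_geometric_eseries_half R 4 0))// ltry.
Qed.

(** Two opposite points t and -t where M is finite suffice: one term of the cosh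
    series gives m_2k <= K (2k)! / t^(2k), and (2k)! <= (2k)^(2k), so that
    C = 1/t works. *)
Lemma bigO_of_cramer (d : measure_display) (T : measurableType d)
    (R : realType) (P : probability T R) (X : {RV P >-> R})
    (hX : finite_moments X) :
  cramer_condition X ->
  exists2 C : R, 0 < C &
    (fun k : nat => moment X (2 * k) : R^o) =O_\oo
    (fun k : nat => (C * (2 * k)%:R) ^+ (2 * k) : R^o).
Proof.
move=> /nbhs_normP[e /= e0 Me].
pose t := e / 2; have t0 : 0 < t by rewrite divr_gt0.
have te : t < e by rewrite /t; lra.
have Mt : ('M_P X t < +oo)%E.
  by apply: Me; rewrite /= sub0r normrN gtr0_norm.
have MNt : ('M_P X (- t) < +oo)%E.
  by apply: Me; rewrite /= sub0r normrN normrN gtr0_norm.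
pose K := fine ('M_P X t + 'M_P X (- t))%E.
have KE : (K%:E = 'M_P X t + 'M_P X (- t))%E.
  by rewrite fineK// ge0_fin_numE ?lte_add_pinfty// adde_ge0// mmt_gen_fun_ge0.
have K0 : 0 <= K by rewrite fine_ge0// adde_ge0// mmt_gen_fun_ge0.
have mK k : t ^+ (2 * k) / (2 * k)`!%:R * moment X (2 * k) <= K.
  by rewrite -lee_fin KE moment_even_le_mmt.
exists t^-1; first by rewrite invr_gt0.
apply/eqO_exP; exists (K + 1); first by rewrite ltr_wpDl.
apply: nearW => k.
rewrite !ger0_norm ?moment_even_ge0//; last first.
  by rewrite exprn_ge0// mulr_ge0// invr_ge0 ltW.
have tn0 : 0 < t ^+ (2 * k) by rewrite exprn_gt0.
apply: (@le_trans _ _ (K * ((2 * k)`!%:R / t ^+ (2 * k)))).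
  rewrite -[(2 * k)`!%:R / _]invf_div ler_pdivlMr.
    by rewrite mulrC.
  by rewrite divr_gt0// ltr0n fact_gt0.
apply: ler_pM => //; first by rewrite divr_ge0// ltW.
  by rewrite lerDl.
rewrite [leRHS]exprMn exprVn [leLHS]mulrC ler_pM2l ?invr_gt0//.
by rewrite -natrX ler_nat fact_le_expn.
Qed.

(** * The equivalence *)

Theorem lemma2 (d : measure_display) (T : measurableType d) (R : realType)
    (P : probability T R) (X : {RV P >-> R}) (hX : finite_moments X) :
  [<-> (exists2 C : R, 0 < C &
          (fun k : nat => moment X (2 * k) : R^o) =O_\oo
          (fun k : nat => (C * (2 * k)%:R) ^+ (2 * k) : R^o));
       (limn_esup (fun k : nat =>
          ((2 * k)%:R^-1 * moment X (2 * k) `^ (2 * k)%:R^-1)%:E) < +oo)%E;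
       (exists2 c0 : R, 0 < c0 &
          forall k : nat, (1 <= k)%N ->
            moment X (2 * k) <= c0 ^+ k * ((2 * k)`!)%:R);
       cramer_condition X].
Proof.
tfae.
- exact: (limn_esup_root_lty (moment_even_ge0 X)).
- exact: (factorial_bound_of_root (moment_even_ge0 X)).
- exact: cramer_of_factorial_bound.
- exact: bigO_of_cramer.
Qed.
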